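(* There exists a randomized online algorithm for the oblivious online single-sink buy-at-bulk problem that produces a routing $P$ such that for every concave cost function $f$, $\mathbb{E}[\mathrm{cost}_f(P)]\le O(\log^2 k)\,\mathrm{OPT}_f$, where $k$ is the number of terminals.
   Context: Oblivious online single-sink buy-at-bulk: there is a metric space $(V,d)$ and a root $r\in V$. Terminals (points of $V$), each with one unit of demand to be sent to $r$, arrive one at a time; the metric is not known in advance: when a terminal arrives, only then are its distances to $r$ and to the previously arrived terminals revealed. Upon arrival of terminal $v$, the algorithm irrevocably chooses a single path $P(v)$ from $v$ to $r$ along which $v$'s unit demand is routed. The algorithm does not know the cost function. For a routing $P=\{P(v)\}$ and a cost function $f:\mathbb{R}_{\ge0}\to\mathbb{R}_{\ge0}$ (concave, nondecreasing, $f(0)=0$), let $\mathrm{load}(e)$ be the number of terminals whose path uses edge $e$, and $\mathrm{cost}_f(P)=\sum_e d(e)\, f(\mathrm{load}(e))$. $\mathrm{OPT}_f$ is the minimum of $\mathrm{cost}_f$ over all (offline) routings of the terminals to $r$. The expectation is over the algorithm's internal randomness, for any fixed input sequence. $k$ is the number of terminals. *)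

(* Defs.v *)
From HB Require Import structures.
From mathcomp Require Import all_boot all_order all_algebra.
From mathcomp Require Import all_classical all_reals all_analysis.

Set Implicit Arguments.
Unset Strict Implicit.
Unset Printing Implicit Defensive.

Import Order.TTheory GRing.Theory Num.Theory.
Import numFieldNormedType.Exports.

Local Open Scope classical_set_scope.
Local Open Scope ring_scope.

(* Only the values of f on [0, +oo[ are constrained (and only those are ever
   used); f need not be continuous at 0. *)
Definition cost_function (R : realType) (f : R -> R) : Prop :=
  [/\ f 0 = 0,
      forall x, 0 <= x -> 0 <= f x,
      forall x y, 0 <= x -> x <= y -> f x <= f y &
      forall x y s, 0 <= x -> 0 <= y -> 0 <= s <= 1 ->
        s * f x + (1 - s) * f y <= f (s * x + (1 - s) * y)].

(* Simple paths in the complete graph on V, given by their vertices. *)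
Definition is_path (V : eqType) (u v : V) (p : seq V) : bool :=
  if p is x :: q then [&& x == u, last x q == v & uniq p] else false.

Definition uses (V : eqType) (p : seq V) (x y : V) : bool :=
  ((x, y) \in zip p (behead p)) || ((y, x) \in zip p (behead p)).

Section Routing.
Variables (R : realType) (V : metricType R) (k : nat).
Implicit Types (r : V) (t : k.-tuple V) (Q : 'I_k -> seq V).

(* Points of V may occur several times among the terminals t; each occurrence
   carries its own unit of demand. *)
Definition is_routing r t Q : Prop := forall i, is_path (tnth t i) r (Q i).

Definition load Q (x y : V) : nat := #|[pred i | uses (Q i) x y]|.

Definition vertices Q : seq V := undup (flatten [seq Q i | i <- enum 'I_k]).

(* The double sum meets every undirected edge {x, y} once in each direction,
   hence the factor 1/2. The pairs that are not edges of Q contribute 0, since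
   f 0 = 0, and so does the diagonal. *)
Definition cost (f : R -> R) Q : R :=
  2^-1 * \sum_(x <- vertices Q) \sum_(y <- vertices Q)
            mdist x y * f (load Q x y)%:R.

(* Offline routings may go through arbitrary points of V. Since V may be
   infinite, the minimum is an infimum; the set is nonempty and bounded below
   by 0 for every cost function f. *)
Definition OPT (f : R -> R) r t : R :=
  inf [set cost f Q | Q in [set Q | is_routing r t Q]].

(* The points known after the arrival of the first terminals: index 0 is the
   root and index j.+1 the terminal number j (counted from 0). *)
Definition point r t (j : nat) : V := nth r (r :: t) j.

Definition revealed r t (n : nat) : 'M[R]_n.+1 :=
  \matrix_(a < n.+1, b < n.+1) mdist (point r t a) (point r t b).

End Routing.

(* A n D is the path chosen for the n-th terminal (n >= 1) when D is the matrix
   of the distances between the root and the first n terminals. It is a sequence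
   of indices of already known points. Earlier choices need not be an argument
   of A: they are determined by A and the leading submatrices of D. *)
Definition online_algorithm (R : realType) : Type :=
  forall n : nat, 'M[R]_n.+1 -> seq 'I_n.+1.

Definition run (R : realType) (A : online_algorithm R) (V : metricType R)
    (k : nat) (r : V) (t : k.-tuple V) : 'I_k -> seq V :=
  fun i => [seq point r t (val j) | j <- A i.+1 (revealed r t i.+1)].

(* A randomized algorithm is a family of deterministic ones indexed by the
   outcomes of a probability space. The measurability condition says that every
   single choice is a (discrete) random variable. *)
Definition randomized_online_algorithm (R : realType) (d : measure_display)
    (Omega : measurableType d) (A : Omega -> online_algorithm R) : Prop :=
  (forall (n : nat) (D : 'M[R]_n.+1) (p : seq 'I_n.+1),
      measurable [set w | A w n D = p]) /\
  (forall (w : Omega) (V : metricType R) (k : nat) (r : V) (t : k.-tuple V),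
      is_routing r t (run (A w) r t)).

(* Main.v *)
Require Import Defs.
From HB Require Import structures.
From mathcomp Require Import all_boot all_order all_algebra.
From mathcomp Require Import all_classical all_reals all_analysis.
From mathcomp Require Import measurable_realfun.
From mathcomp Require Import zify ring lra.
Import Order.TTheory GRing.Theory Num.Theory.
Import numFieldNormedType.Exports.
Import HBNNSimple.
Local Open Scope classical_set_scope.
Local Open Scope ring_scope.

Set Implicit Arguments.
Unset Strict Implicit.
Unset Printing Implicit Defensive.

(* At every scale 2^e, a random low-diameter clustering of V is revealed online:
   x belongs to the first known point p_j, in order of arrival, with
   d(p_j, x) <= rho_j 2^e, where the rho_j are nearly independent truncated
   exponential variables on [1, 3] of rate O(log j). This separates x from y
   with probability O(log k) d(x, y) / 2^e. The n-th terminal is routed through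
   its centers at the n scales below d(r, p_n), and ends at the root, which is
   its center at the top scale.
   Let Q be any routing. The terminals that share their centers at two consecutive
   scales, these being not both r, leave their class along edges of Q that are
   cut; so by subadditivity of f the cost of the hops of scale 2^e is
   at most O(2^e) times the sum of f(load_Q) over the cut edges, which is
   O(log k) cost_f(Q) on average. Only the O(log k) scales between D / k and D,
   where D is the largest distance to r, matter: all other hops together cost
   O(f(1) D), which is O(cost_f(Q)). *)

(** * Subadditive costs and cuts *)

(** Concavity between [0] and [x + y], with [f 0 = 0], gives [x] and [y] at least their proportional
    shares of [f (x + y)]. *)
Lemma cost_function_subadd (R : realType) (f : R -> R) (x y : R) :
  cost_function f -> 0 <= x -> 0 <= y -> f (x + y) <= f x + f y.
Proof.
case=> f0 fge0 fmono fconc x0 y0.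
have [xy0|xyn0] := eqVneq (x + y) 0.
  by rewrite xy0 f0 addr_ge0 ?fge0.
have xy_gt0 : 0 < x + y by rewrite lt_neqAle eq_sym xyn0 addr_ge0.
have share (z : R) : 0 <= z -> z <= x + y -> z / (x + y) * f (x + y) <= f z.
  move=> z0 zle.
  have := fconc (x + y) 0 (z / (x + y)) (ltW xy_gt0) (lexx 0).
  rewrite f0 !mulr0 !addr0 divfK//; apply.
  by rewrite divr_ge0 ?(ltW xy_gt0)//= ler_pdivrMr ?mul1r.
have hx := share x x0; have hy := share y y0.
rewrite (_ : f (x + y) = x / (x + y) * f (x + y) + y / (x + y) * f (x + y)).
  by apply: lerD; [apply: hx; rewrite lerDl|apply: hy; rewrite lerDr].
by rewrite -mulrDl -mulrDl divff// mul1r.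
Qed.

Lemma cost_function_sum (R : realType) (f : R -> R) (I : Type) (s : seq I)
    (P : pred I) (n : I -> nat) :
  cost_function f ->
  f (\sum_(i <- s | P i) n i)%N%:R <= \sum_(i <- s | P i) f (n i)%:R.
Proof.
move=> hf; have [f0 _ _ _] := hf.
elim/big_ind2: _ => [|a b c d ha hc|//]; first by rewrite f0.
by rewrite natrD; apply: le_trans (lerD ha hc); apply: cost_function_subadd.
Qed.

Lemma sum_pred1_le (R : realType) (T : eqType) (s : seq T) (e : T)
    (g : T -> R) :
  uniq s -> 0 <= g e -> \sum_(x <- s | x == e) g x <= g e.
Proof.
move=> us ge0; rewrite -big_filter.
have [es|es] := boolP (e \in s).
  by rewrite (_ : [seq x <- s | x == e] = [:: e]) ?big_seq1// filter_pred1_uniq.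
rewrite (_ : [seq x <- s | x == e] = [::]) ?big_nil//.
by apply/eqP; rewrite -[_ == _]negbK -has_filter has_pred1.
Qed.

Lemma sum_uniq_subset (R : realType) (T : eqType) (s1 s2 : seq T)
    (g : T -> R) :
  uniq s1 -> uniq s2 -> {subset s1 <= s2} -> (forall x, 0 <= g x) ->
  \sum_(x <- s1) g x <= \sum_(x <- s2) g x.
Proof.
move=> u1 u2 s12 g0.
rewrite [X in _ <= X](bigID (mem s1))/= -[X in X <= _]addr0.
apply: lerD; last by rewrite sumr_ge0.
rewrite -[X in _ <= X]big_filter; rewrite (perm_big [seq x <- s2 | x \in
  s1])//; apply: uniq_perm => //.
  exact: filter_uniq.
by move=> x; rewrite mem_filter; case: (boolP (x \in s1)) => //= /s12 ->.
Qed.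

Lemma card_le_sum (I J : finType) (A : pred I) (P : pred J)
    (B : J -> pred I) :
  (forall i, A i -> exists2 j, P j & B j i) ->
  (#|A| <= \sum_(j | P j) #|B j|)%N.
Proof.
move=> hA; rewrite -sum1_card big_mkcond/=.
under [X in (_ <= X)%N]eq_bigr do rewrite -sum1_card big_mkcond/=.
rewrite exchange_big/=; apply: leq_sum => i _.
rewrite !unfold_in; case: ifP => // /hA[j Pj Bji].
by rewrite (bigD1 j)//= !unfold_in Bji.
Qed.

Section Routings.
Context (R : realType) (V : metricType R) (k : nat).
Implicit Types (r : V) (t : k.-tuple V) (Q : 'I_k -> seq V) (f : R -> R).

Lemma mem_zip_behead (T : eqType) (p : seq T) x y :
  (x, y) \in zip p (behead p) -> (x \in p) && (y \in p).
Proof.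
case: p => [//|a p]; elim: p a => [//|b p ih] a /=.
rewrite inE => /orP[/eqP[-> ->]|/ih /andP[h1 h2]].
  by rewrite !inE !eqxx orbT.
by rewrite !(in_cons a) h1 h2 !orbT.
Qed.

Lemma uses_vertices Q i x y :
  uses (Q i) x y -> (x \in vertices Q) && (y \in vertices Q).
Proof.
move=> h; have /andP[hx hy] : (x \in Q i) && (y \in Q i).
  by case/orP: h => /mem_zip_behead // /andP[-> ->].
by rewrite !mem_undup; apply/andP; split; apply/flattenP; exists (Q i) => //;
  apply: map_f; rewrite mem_enum.
Qed.

Lemma cost_ge0 f Q : cost_function f -> 0 <= cost f Q.
Proof.
move=> [_ fge0 _ _]; rewrite mulr_ge0// sumr_ge0// => x _.
by rewrite sumr_ge0// => y _; rewrite mulr_ge0// ?mdist_ge0// fge0.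
Qed.

(** The load of an edge is at most the total size of the classes whose label names it, so
    subadditivity charges [f] of the load to these classes. A label fixes one orientation while the
    double sum meets both, which absorbs the factor 1/2. *)
Lemma cost_le_labels f Q (L : finType) (a : L -> pred 'I_k) (E : L -> V * V) :
  cost_function f ->
  (forall i x y, uses (Q i) x y -> x != y ->
     exists2 l, a l i & (E l == (x, y)) || (E l == (y, x))) ->
  cost f Q <= \sum_l mdist (E l).1 (E l).2 * f #|a l|%:R.
Proof.
move=> hf hE; have [f0 fge0 fmono _] := hf.
pose T x y l := (E l == (x, y)) || (E l == (y, x)).
have term x y : mdist x y * f (load Q x y)%:R <=
    \sum_(l | T x y l) mdist x y * f #|a l|%:R.
  have [->|xy] := eqVneq x y; first by rewrite mdistxx mul0r sumr_ge0// => l _;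
    rewrite mul0r.
  rewrite -mulr_sumr ler_wpM2l ?mdist_ge0//.
  apply: le_trans (cost_function_sum _ _ _ hf).
  apply: fmono => //; rewrite ler_nat; apply: card_le_sum => i hi.
  by have [l al Tl] := hE i x y hi xy; exists l.
rewrite /cost mulrC ler_pdivrMr//.
apply: le_trans (_ : \sum_(x <- vertices Q) \sum_(y <- vertices Q)
  \sum_l ((if E l == (x, y) then mdist x y * f #|a l|%:R else 0) +
          (if E l == (y, x) then mdist x y * f #|a l|%:R else 0)) <= _).
  apply: ler_sum => x _; apply: ler_sum => y _; apply: (le_trans (term x y)).
  rewrite big_mkcond; apply: ler_sum => l _; rewrite /T.
  have h : 0 <= mdist x y * f #|a l|%:R by rewrite mulr_ge0 ?mdist_ge0 ?fge0.
  by case: (_ == _); case: (_ == _); rewrite /= ?addr0 ?add0r ?lerDl.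
under eq_bigr do rewrite exchange_big/=.
rewrite exchange_big/= mulr_suml; apply: ler_sum => l _.
set F := f _.
have Fge0 : 0 <= F by rewrite fge0.
have h : forall e1 e2 : V, \sum_(x <- vertices Q) \sum_(y <- vertices Q)
   (if (e1, e2) == (x, y) then mdist x y * F else 0) <= mdist e1 e2 * F.
  move=> e1 e2; apply: le_trans (sum_pred1_le (s := vertices Q) (e := e1)
    (g := fun x => mdist x e2 * F) (undup_uniq _) _); last first.
    by rewrite mulr_ge0 ?mdist_ge0.
  rewrite [X in _ <= X]big_mkcond; apply: ler_sum => x _.
  under eq_bigr do rewrite xpair_eqE eq_sym.
  case: (x == e1) => /=; last by rewrite big1.
  rewrite -big_mkcond/=; under eq_bigl do rewrite eq_sym.
  by apply: (sum_pred1_le (g := fun y => mdist x y * F));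
    rewrite ?undup_uniq// mulr_ge0 ?mdist_ge0.
under eq_bigr do rewrite big_split/=.
rewrite big_split/= [X in _ + X]exchange_big/= (_ : 2 = 1 + 1)// mulrDr mulr1.
case: (E l) => e1 e2 /=; apply: lerD; first exact: h.
under eq_bigr do under eq_bigr do rewrite metric_sym.
exact: h.
Qed.

Lemma path_crossing (P : pred V) u v p :
  is_path u v p -> P u -> ~~ P v ->
  exists x y, [/\ (x, y) \in zip p (behead p), P x & ~~ P y].
Proof.
case: p => [//|a p] /and3P[/eqP-> /eqP<- _].
elim: p u => [|b p ih] u /= Pu Pv; first by rewrite Pu in Pv.
have [Pb|Pb] := boolP (P b).
  have [x [y [h1 h2 h3]]] := ih b Pb Pv.
  by exists x, y; split => //; rewrite inE h1 orbT.
by exists u, b; rewrite inE eqxx.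
Qed.

(** A terminal whose class is not that of [r] leaves its class along its path, so the pairs leaving
    a class carry at least its size. An ordered pair leaves only the class of its first end, hence
    is charged at most once. *)
Lemma cut_cost f r t Q (L : finType) (c : V -> L) :
  cost_function f -> is_routing r t Q ->
  \sum_(l | l != c r) f #|[pred i | c (tnth t i) == l]|%:R <=
  \sum_(x <- vertices Q) \sum_(y <- vertices Q)
     (if c x != c y then f (load Q x y)%:R else 0).
Proof.
move=> hf hQ; have [f0 fge0 fmono _] := hf.
set vs := vertices Q; pose D := [seq (x, y) | x <- vs, y <- vs].
have -> : \sum_(x <- vs) \sum_(y <- vs)
     (if c x != c y then f (load Q x y)%:R else 0) =
   \sum_(e <- D) (if c e.1 != c e.2 then f (load Q e.1 e.2)%:R else 0).
  by rewrite big_allpairs.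
pose G l (e : V * V) := (c e.1 == l) && (c e.2 != l).
apply: le_trans (_ : \sum_(l | l != c r)
   \sum_(e <- D | G l e) f (load Q e.1 e.2)%:R <= _).
  apply: ler_sum => l lr.
  apply: le_trans (cost_function_sum _ _ _ hf).
  apply: fmono => //; rewrite ler_nat.
  rewrite big_tnth; apply: card_le_sum => i /eqP cl /=.
  have [] := @path_crossing (fun x => c x == l) _ _ _ (hQ i).
  - by rewrite cl.
  - by rewrite eq_sym.
  move=> x [y [xy cx cy]].
  have uxy : uses (Q i) x y by rewrite /uses xy.
  have xyD : (x, y) \in D.
    by have /andP[? ?] := uses_vertices uxy; apply/allpairsP; exists (x, y).
  have /seq_tnthP[j ej] := xyD.
  by exists j; rewrite -ej /G ?cx.
under eq_bigr do rewrite big_mkcond/=.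
rewrite exchange_big/=; apply: ler_sum => e _.
have [cxy|cxy] := eqVneq (c e.1) (c e.2); rewrite /=.
  by rewrite big1// => l _; rewrite /G cxy andbN.
apply: le_trans (_ : \sum_(l | l == c e.1) f (load Q e.1 e.2)%:R <= _).
  rewrite big_mkcond [X in _ <= X]big_mkcond/=; apply: ler_sum => l _.
  rewrite /G (eq_sym (c e.1)); case: (l != c r); case: (l == c e.1) => //=.
    by case: ifP => // _; rewrite fge0.
  by rewrite fge0.
by rewrite big_pred1_eq.
Qed.

Lemma mdist_path_le u v (p : seq V) :
  is_path u v p -> mdist u v <= \sum_(e <- zip p (behead p)) mdist e.1 e.2.
Proof.
case: p => [//|a p] /and3P[/eqP-> /eqP<- _].
elim: p u => [|b p ih] u /=; first by rewrite mdistxx big_nil.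
rewrite big_cons/=; apply: le_trans (metric_triangle _ b _) _.
by rewrite lerD2l.
Qed.

(** Every edge on the path of [i] has load at least 1. The ordered pairs along a simple path are
    distinct, so they form part of the double sum, which is [2 * cost f Q]. *)
Lemma cost_ge_mdist f r t Q i :
  cost_function f -> is_routing r t Q ->
  f 1 * mdist (tnth t i) r <= 2 * cost f Q.
Proof.
move=> hf hQ; have [f0 fge0 fmono _] := hf.
rewrite /cost mulrA divff ?mul1r//.
rewrite (_ : \sum_(x <- _) _ = \sum_(e <- [seq (x, y) | x <- vertices Q,
   y <- vertices Q]) mdist e.1 e.2 * f (load Q e.1 e.2)%:R);
     last by rewrite big_allpairs.
apply: le_trans (ler_wpM2l _ (mdist_path_le (hQ i))) _; first exact: fge0.
rewrite mulr_sumr.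
apply: le_trans (_ : \sum_(e <- zip (Q i) (behead (Q i))) mdist e.1 e.2 * f
  (load Q e.1 e.2)%:R <= _).
  rewrite big_seq [X in _ <= X]big_seq; apply: ler_sum => -[x y] /= xy.
  rewrite mulrC ler_wpM2l ?mdist_ge0//; apply: fmono => //.
  by rewrite ler1n; apply/card_gt0P; exists i; rewrite inE /uses xy.
apply: sum_uniq_subset.
- move: (hQ i); case: (Q i) => [//|a p] /and3P[_ _]; exact: zip_uniql.
- by apply: allpairs_uniq; rewrite ?undup_uniq// => -[? ?] [? ?].
- move=> [x y] xy; have /andP[? ?] : (x \in vertices Q) && (y \in vertices Q).
    by apply: (@uses_vertices Q i); rewrite /uses xy.
  by apply/allpairsP; exists (x, y).
- by move=> e; rewrite mulr_ge0 ?mdist_ge0 ?fge0.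
Qed.

End Routings.

(** * Nearly independent uniform variables from one uniform variable *)

Section Digits.
Context (R : realType).
Implicit Types (w z : R) (m : nat -> R).

(** The inverses telescope to a sum of at most 1/2, which keeps the total error bounded, while the
    logarithm, later the rate of the exponential law, stays [O(log j)]. *)
Definition radix (j : nat) : nat := (2 * j.+1 * j.+2)%N.

Definition place (j : nat) : nat := (\prod_(i < j) radix i)%N.

Definition slack (j : nat) : R := (radix j)%:R^-1.

(* The tail of the mixed-radix expansion of [w] from its [j]-th digit on. When
   [w] is uniform on [0, 1[, it is uniform and independent of the digits before
   the [j]-th one, which determine [rnd i w] up to [slack i] for [i < j]. *)
Definition rnd (j : nat) w : R :=
  w * (place j)%:R - (Num.floor (w * (place j)%:R))%:~R.

Lemma radix_gt0 j : (0 < radix j)%N. Proof. by rewrite !muln_gt0. Qed.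

Lemma place_gt0 j : (0 < place j)%N.
Proof. by rewrite prodn_gt0// => i; exact: radix_gt0. Qed.

Lemma placeS j : place j.+1 = (place j * radix j)%N.
Proof. by rewrite /place big_ord_recr. Qed.

Lemma slack_gt0 j : 0 < slack j.
Proof. by rewrite invr_gt0 ltr0n radix_gt0. Qed.

Lemma slackE j : slack j = 2^-1 * (j.+1%:R^-1 - j.+2%:R^-1).
Proof.
rewrite /slack /radix !natrM; have : j.+1%:R != 0 :> R by rewrite pnatr_eq0.
have : j.+2%:R != 0 :> R by rewrite pnatr_eq0.
have -> : j.+2%:R = j.+1%:R + 1 :> R by rewrite -natr1.
by move=> h1 h2; field; apply/andP.
Qed.

Lemma slack_le1 j : slack j <= 4^-1.
Proof.
by rewrite lef_pV2 ?posrE ?ltr0n ?radix_gt0// ler_nat /radix; lia.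
Qed.

Lemma rnd_ge0 j w : 0 <= rnd j w.
Proof. by rewrite subr_ge0; have /andP[] := floor_itv (w * (place j)%:R). Qed.

Lemma rnd_lt1 j w : rnd j w < 1.
Proof.
rewrite ltrBlDl; have /andP[_] := floor_itv (w * (place j)%:R).
by rewrite intrD.
Qed.

Lemma measurable_rnd j : measurable_fun setT (rnd j).
Proof.
apply: measurable_funB; first exact: measurable_funM.
apply: nondecreasing_measurable => // x y xy.
by rewrite ler_int; apply: le_floor; rewrite ler_wpM2r.
Qed.

Lemma measurable_rnd_lt j z : measurable [set w | rnd j w < z].
Proof.
have := measurable_rnd j measurableT (measurable_itv `]-oo, z[).
by rewrite setTI; congr (measurable _); apply/seteqP; split => w /=;
  rewrite in_itv.
Qed.

(* Up to the resolution of its leading digits, [rnd i w] with [i < j] is a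
   function of [floor (w * place j)], and [cells m j] lists the values of that
   integer which are compatible with [m i <= rnd i w] for all [i < j]. *)
Fixpoint cells m (j : nat) : seq nat :=
  if j is i.+1 then
    [seq (c * radix i + d)%N | c <- cells m i,
       d <- iota (Num.truncn (m i * (radix i)%:R))
                 (radix i - Num.truncn (m i * (radix i)%:R))]
  else [:: 0%N].

Lemma cells_cover m j w : (forall i, 0 <= m i) -> 0 <= w < 1 ->
  (forall i, (i < j)%N -> m i <= rnd i w) ->
  exists2 c, c \in cells m j & rnd j w = w * (place j)%:R - c%:R.
Proof.
move=> m0 w01; elim: j => [_|j ih hj].
  exists 0%N; rewrite ?mem_head// /rnd /place big_ord0 mulr1.
  by rewrite (floor_def (m := 0)).
have [c cj ec] := ih (fun i ij => hj i (ltnW ij)).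
have N0 : 0 < (radix j)%:R :> R by rewrite ltr0n radix_gt0.
set u := rnd j w * (radix j)%:R.
have u0 : 0 <= u by rewrite mulr_ge0 ?rnd_ge0 ?ltW.
have /andP[d1 d2] := truncn_itv u0.
(* The next digit is the integer part of [rnd j w * radix j], and [m j <= rnd j w] bounds it below
   as [cells] demands. *)
exists (c * radix j + Num.truncn u)%N; last first.
  rewrite /rnd (floor_def (m := (c * radix j + Num.truncn u)%N)); first by [].
  have -> : w * (place j.+1)%:R = c%:R * (radix j)%:R + u.
    by rewrite /u ec placeS natrM; ring.
  rewrite -!pmulrn natrD natrM lerD2l d1/=.
  by rewrite addn1 -addnS natrD natrM ltrD2l.
apply/allpairsP; exists (c, Num.truncn u); split => //=.
rewrite mem_iota; apply/andP; split.
  apply: le_truncn; rewrite ler_wpM2r ?(ltW N0)//; exact: hj.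
rewrite subnKC; last first.
  rewrite -(ler_nat R); apply: (le_trans (y := m j * (radix j)%:R));
    first rewrite truncn_le.
    by rewrite mulr_ge0// ltW.
  rewrite ler_piMl ?(ltW N0)//; apply: le_trans (ltW (rnd_lt1 j w)).
  exact: hj.
rewrite -(ltr_nat R); apply: le_lt_trans d1 _.
by rewrite /u gtr_pMl// rnd_lt1.
Qed.

(** Level [j] keeps at most [(1 - m j) * radix j + 1] digits because of rounding; the extra 1,
    divided by [radix j], is [slack j]. *)
Lemma size_cells m j : (forall i, 0 <= m i <= 1) ->
  (size (cells m j))%:R <=
    (place j)%:R * \prod_(i < j) (1 - m i + slack i).
Proof.
move=> m01; elim: j => [|j ih]; first by rewrite /place !big_ord0 mulr1.
rewrite /= size_allpairs size_iota placeS big_ord_recr/= natrM (natrM _ (place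
  j)).
have /andP[m0 m1] := m01 j.
have N0 : 0 < (radix j)%:R :> R by rewrite ltr0n radix_gt0.
set q := Num.truncn _.
have q1 : m j * (radix j)%:R < q.+1%:R.
  by have /andP[] := truncn_itv (mulr_ge0 m0 (ltW N0)).
have qN : (q <= radix j)%N.
  rewrite -(ler_nat R); apply: (le_trans (y := m j * (radix j)%:R));
    first rewrite truncn_le.
    by rewrite mulr_ge0// ltW.
  by rewrite ler_piMl ?(ltW N0).
rewrite mulrACA ler_pM//.
rewrite natrB// mulrDr /slack divff ?gt_eqF// mulrBr mulr1.
rewrite -natr1 in q1; lra.
Qed.

Lemma slack_prod_le m j : (forall i, 0 <= m i <= 1) ->
  \prod_(i < j) (1 - m i + slack i) <= 2.
Proof.
move=> m01.
have t0 n : 0 < 1 + n.+1%:R^-1 :> R by rewrite ltr_pwDl.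
(* The extra factor makes the bound inductive: the left side starts at 2, and
   [(1 + slack j) * (1 + 1 / (j + 2))] is at most [1 + 1 / (j + 1)]. *)
suff h : \prod_(i < j) (1 - m i + slack i) * (1 + j.+1%:R^-1) <= 2.
  apply: le_trans h; rewrite ler_peMr ?lerDl ?invr_ge0//.
  by rewrite prodr_ge0// => i _; have /andP[_ ?] := m01 i;
     rewrite addr_ge0 ?subr_ge0// ltW ?slack_gt0.
elim: j => [|j ih]; first by rewrite big_ord0 mul1r invr1.
rewrite big_ord_recr/= -mulrA; apply: le_trans ih.
have /andP[m0 m1] := m01 j.
apply: ler_wpM2l.
  by rewrite prodr_ge0// => i _; have /andP[_ ?] := m01 i;
     rewrite addr_ge0 ?subr_ge0// ltW ?slack_gt0.
apply: le_trans (_ : (1 + slack j) * (1 + j.+2%:R^-1) <= _).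
  by apply: ler_wpM2r; [exact: ltW|rewrite lerD2r gerBl].
rewrite slackE; set a := j.+1%:R^-1; set b := j.+2%:R^-1.
have b0 : 0 < b by rewrite invr_gt0.
have b1 : b <= 1 by rewrite invf_le1 ?ler1n.
have ab : b <= a by rewrite lef_pV2 ?posrE// ler_nat.
nra.
Qed.

Lemma slack_sum_le j : \sum_(i < j) slack i <= 2^-1.
Proof.
suff -> : \sum_(i < j) slack i = 2^-1 * (1 - j.+1%:R^-1).
  by rewrite ler_piMr// gerBl.
elim: j => [|j ih]; first by rewrite big_ord0 invr1 subrr mulr0.
by rewrite big_ord_recr/= ih slackE; ring.
Qed.

(** Without slack the terms telescope to at most 1, like probabilities of disjoint first hits. With
    [q i] the product of the first [i] factors, each term is [q i - q i.+1 + 2 * q i * slack i], and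
    [q i <= 2] bounds the total error by 2. *)
Lemma hit_sum_le m j : (forall i, 0 <= m i <= 1) ->
  \sum_(i < j) \prod_(l < i) (1 - m l + slack l) * (m i + slack i) <= 3.
Proof.
move=> m01; pose q i := \prod_(l < i) (1 - m l + slack l).
have q0 i : 0 <= q i.
  by rewrite prodr_ge0// => l _; have /andP[_ ?] := m01 l;
     rewrite addr_ge0 ?subr_ge0// ltW ?slack_gt0.
suff h : \sum_(i < j) q i * (m i + slack i) <=
    1 - q j + 4 * \sum_(i < j) slack i.
  by have := slack_sum_le j; have := q0 j; move: h; rewrite /q; lra.
elim: j => [|j ih]; first by rewrite /q !big_ord0; lra.
rewrite !big_ord_recr/=.
have -> : q j.+1 = q j * (1 - m j + slack j) by rewrite /q big_ord_recr.
have := slack_prod_le j m01; rewrite -/(q j) => q2.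
have s0 := slack_gt0 j; nra.
Qed.

Definition coin : probability _ R := uniform_prob (@ltr01 R).

(** The density is 1 on the unit interval. The endpoint 1 is a null set, dropped because the digit
    expansions need [w < 1]. *)
Lemma coin_le (A : set R) : measurable A ->
  (coin A <= lebesgue_measure (A `&` `[0%R, 1%R[%classic))%E.
Proof.
move=> mA; apply: (@le_trans _ _ (lebesgue_measure (A `&` `[0%R,
  1%R]%classic))).
  rewrite /coin /= /uniform_prob integral_uniform_pdf.
  apply: (@le_trans _ _ (\int[lebesgue_measure]_(x in A `&` `[0%R,
    1%R]%classic) 1%:E))%E; last first.
    by rewrite integral_cst//= ?mul1e//; exact: measurableI.
  apply: ge0_le_integral => //=.
  - exact: measurableI.
  - by move=> x _; rewrite lee_fin uniform_pdf_ge0.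
  - by apply/measurable_EFinP/measurable_funTS; exact: measurable_uniform_pdf.
  - by move=> x [Ax]; rewrite in_itv/= /uniform_pdf => ->; rewrite subr0 invr1.
have mB : measurable (A `&` `[0%R, 1%R[%classic) by exact: measurableI.
apply: (@le_trans _ _ (lebesgue_measure ((A `&` `[0%R, 1%R[%classic) `|` [set
  1%R]))).
  apply: le_measure; rewrite ?inE.
  - exact: measurableI.
  - exact: measurableU.
  move=> w [Aw] /=; rewrite !in_itv/= => /andP[w0 w1].
  by have [->|w1n] := eqVneq w 1; [right|left; rewrite w0 lt_neqAle w1n w1].
have m1 : lebesgue_measure [set 1%R : R] = 0%E by exact: lebesgue_measure_set1.
rewrite -[X in (_ <= X)%E]adde0 -m1; exact: measureU2.
Qed.

Definition first_hit m j (a b : R) : set R :=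
  [set w | (forall i, (i < j)%N -> m i <= rnd i w) /\ a <= rnd j w < b].

Lemma measurable_first_hit m j (a b : R) : measurable (first_hit m j a b).
Proof.
set E := first_hit _ _ _ _.
have -> : E = (\bigcap_(i in `I_j) ~` [set w | rnd i w < m i]) `&`
   (~` [set w | rnd j w < a] `&` [set w | rnd j w < b]).
  apply/seteqP; split => [w [h1 /andP[h2 h3]]|w [h1 [h2 h3]]] /=.
    split; first by move=> i /= ij; apply/negP; rewrite -leNgt; exact: h1.
    by split => //; apply/negP; rewrite -leNgt.
  split; first by move=> i ij; move: (h1 i ij) => /negP; rewrite -leNgt.
  by rewrite leNgt h3 andbT; exact/negP.
apply: measurableI.
  by apply: bigcap_measurableType => i _; apply: measurableC; exact:
    measurable_rnd_lt.
by apply: measurableI; [apply: measurableC|]; exact: measurable_rnd_lt.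
Qed.

(** Each cell of [cells m j] confines [w] to an interval of length [(b - a) / place j]; in the union
    bound, [place j] cancels against [size_cells]. *)
Lemma coin_first_hit m j (a b : R) :
  (forall i, 0 <= m i <= 1) -> 0 <= a <= b ->
  (coin (first_hit m j a b)
     <= (\prod_(i < j) (1 - m i + slack i) * (b - a))%:E)%E.
Proof.
move=> m01 /andP[a0 ab]; set E := first_hit _ _ _ _.
have mE : measurable E by exact: measurable_first_hit.
apply: (le_trans (coin_le mE)).
set s := cells m j; set S := (place j)%:R : R.
have S0 : 0 < S by rewrite ltr0n place_gt0.
pose I n : set R := `[((nth 0%N s n)%:R + a) / S, ((nth 0%N s n)%:R + b) /
  S]%classic.
apply: (@le_trans _ _ (lebesgue_measure (\big[setU/set0]_(n < size s) I n))).
  apply: le_measure; rewrite ?inE.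
  - exact: measurableI.
  - by apply: bigsetU_measurable => n _; exact: measurable_itv.
  move=> w [[h1 /andP[h2 h3]]] /=; rewrite in_itv/= => w01.
  have m0 i : 0 <= m i by case/andP: (m01 i).
  have [c cs ec] := cells_cover m0 w01 h1.
  rewrite -bigcup_mkord; exists (index c s); first by rewrite /= index_mem.
  rewrite /I /= nth_index// in_itv/= ler_pdivrMr// ler_pdivlMr//.
  move: h2 h3; rewrite ec -/S; lra.
apply: le_trans (Boole_inequality _ _) _ => [n _|]; first exact: measurable_itv.
apply: (@le_trans _ _ (\sum_(n < size s) ((b - a) / S)%:E)%E).
  apply: lee_sum => n _; change (lebesgue_measure (I n) <= ((b - a) / S)%:E)%E.
  rewrite /I; set c := (nth _ _ _)%:R.
  rewrite lebesgue_measure_itv /=; case: ifP => _; last first.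
    by rewrite lee_fin divr_ge0 ?subr_ge0// ltW.
  by rewrite -EFinD lee_fin -mulrBl ler_wpM2r ?invr_ge0 ?(ltW S0)//; lra.
rewrite sumEFin lee_fin sumr_const card_ord -mulr_natl mulrA ler_pdivrMr//.
rewrite mulrAC ler_wpM2r ?subr_ge0// mulrC; exact: size_cells.
Qed.

End Digits.

(** * Random clusterings *)

Section Thresholds.
Context (R : realType).
Implicit Types (w z a b : R) (g h : nat -> R).

Definition rate (j : nat) : R := ln (radix j)%:R.

(** The tail of the law of [rho_j]: the event [rnd j w < threshold j z] encodes [z <= rho_j].
    Clamping the exponential and then shifting it makes the tail exactly 1 up to [z = 1] and exactly
    0 from [z = 3] on. *)
Definition threshold (j : nat) z : R :=
  Num.max (slack R j) (Num.min (1 + slack R j) (expR (rate j * (2 - z))))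
    - slack R j.

Lemma rate_ge0 j : 0 <= rate j.
Proof. by rewrite ln_ge0// ler1n radix_gt0. Qed.

Lemma threshold_ge0 j z : 0 <= threshold j z.
Proof. by rewrite subr_ge0 le_max lexx. Qed.

Lemma threshold_le1 j z : threshold j z <= 1.
Proof.
by rewrite lerBlDr ge_max lerDr ler01 ge_min lexx.
Qed.

Lemma threshold_near j z : z <= 1 -> threshold j z = 1.
Proof.
move=> z1; rewrite /threshold min_l; first by rewrite max_r ?addrK// lerDr.
apply: le_trans (_ : (radix j)%:R <= _); last first.
  rewrite -[X in X <= _]lnK ?posrE ?ltr0n ?radix_gt0// ler_expR -/(rate j).
  by rewrite ler_peMr ?rate_ge0//; lra.
apply: le_trans (_ : 1 + 4^-1 <= _); first by rewrite lerD2l slack_le1.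
apply: le_trans (_ : 4 <= _); first by lra.
by rewrite ler_nat /radix; lia.
Qed.

Lemma threshold_far j z : 3 <= z -> threshold j z = 0.
Proof.
move=> z3; apply/eqP; rewrite subr_eq0; apply/eqP/max_l.
rewrite ge_min; apply/orP; right.
rewrite -[slack R j]lnK ?posrE ?slack_gt0// ler_expR /slack lnV ?posrE ?ltr0n
  ?radix_gt0//.
by rewrite -/(rate j); have := rate_ge0 j; nra.
Qed.

Lemma threshold_mono j a b : a <= b -> threshold j b <= threshold j a.
Proof.
move=> ab; rewrite /threshold lerD2r.
set e := slack R j; set u := expR (rate j * (2 - a)).
set v := expR (rate j * (2 - b)).
have vu : v <= u by rewrite ler_expR ler_wpM2l ?rate_ge0// lerD2l lerN2.
case: (leP (1 + e) v) => ?; case: (leP (1 + e) u) => ?; case: (leP e v) => ?;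
  case: (leP e u) => ?; case: (leP e (1 + e)) => ?; lra.
Qed.

(* The relative Lipschitz bound characteristic of exponential laws. *)
Lemma threshold_lipschitz j a b : a <= b ->
  threshold j a - threshold j b <=
    rate j * (b - a) * (threshold j a + slack R j).
Proof.
move=> ab; rewrite /threshold subrK opprB addrA subrK.
set e := slack R j; set s := rate j * (b - a).
have s0 : 0 <= s by rewrite mulr_ge0 ?rate_ge0 ?subr_ge0.
set u := expR (rate j * (2 - a)); set v := expR (rate j * (2 - b)).
have e0 : 0 < e by exact: slack_gt0.
have u0 : 0 < u by exact: expR_gt0.
have v0 : 0 < v by exact: expR_gt0.
have uv : u * (1 - s) <= v.
  rewrite /v (_ : rate j * (2 - b) = rate j * (2 - a) - s);
    last by rewrite /s; ring.
  by rewrite expRD ler_wpM2l ?expR_ge0// expR_ge1Dx.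
(* The same decay from the upper clamping value; for [s > 1] the left side is negative. *)
have big : 1 + e <= u -> (1 + e) * (1 - s) <= v.
  move=> eu; have [s1|s1] := leP s 1.
    by apply: le_trans uv; rewrite ler_wpM2r ?subr_ge0.
  apply: le_trans (ltW v0); rewrite mulr_ge0_le0//;
    first by rewrite addr_ge0// ltW.
  by rewrite subr_le0 ltW.
have se : 0 <= s * e by rewrite mulr_ge0// ltW.
have su : 0 <= s * u by rewrite mulr_ge0// ltW.
case: (leP (1 + e) v) => ?; case: (leP (1 + e) u) => [/big ?|?];
  case: (leP e v) => ?; case: (leP e u) => ?; case: (leP e (1 + e)) => ?; nra.
Qed.

(** The outcome [w] enters the algorithm only through finitely many such comparisons, so that every
    function of the answers is measurable. *)
Definition answers w (qss : seq (seq (nat * R))) : seq (seq bool) :=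
  [seq [seq rnd q.1 w < q.2 | q <- qs] | qs <- qss].

Lemma measurable_answers (S : set (seq (seq bool))) qss :
  measurable [set w | S (answers w qss)].
Proof.
have flat qs (S' : set (seq bool)) :
    measurable [set w | S' [seq rnd q.1 w < q.2 | q <- qs]].
  elim: qs S' => [|q qs ih] S' /=.
    have [h|h] := pselect (S' [::]).
      by rewrite (_ : [set _ | _] = setT) //; apply/seteqP; split.
    by rewrite (_ : [set _ | _] = set0) //; apply/seteqP; split.
  rewrite (_ : [set w | _] =
    ([set w | rnd q.1 w < q.2] `&`
       [set w | (S' \o cons true) [seq rnd q.1 w < q.2 | q <- qs]]) `|`
    (~` [set w | rnd q.1 w < q.2] `&`
       [set w | (S' \o cons false) [seq rnd q.1 w < q.2 | q <- qs]])).
    by apply: measurableU; apply: measurableI => //; try apply: measurableC;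
       exact: measurable_rnd_lt.
  apply/seteqP; split => w /=.
    by case: (rnd _ _ < _) => h; [left|right].
  by case=> -[+ h]; [move=> e; rewrite e in h *|move=> /negP/negbTE ->].
rewrite (_ : [set w | _] = [set w | (S \o reshape (shape qss))
   [seq rnd q.1 w < q.2 | q <- flatten qss]]); first exact: flat.
by apply/seteqP; split => w /=; rewrite -map_reshape flattenK.
Qed.

(** The value is [n] when nothing is hit. Searching a list of answers makes this convertible to what
    the algorithm computes. *)
Definition hit w g (n : nat) : nat :=
  find id [seq rnd q.1 w < q.2 | q <- [seq (j, g j) | j <- iota 0 n]].

Lemma hitE w g n : hit w g n = find (fun j => rnd j w < g j) (iota 0 n).
Proof. by rewrite /hit -map_comp find_map. Qed.

Lemma hit_le w g n : (hit w g n <= n)%N.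
Proof.
by rewrite hitE; apply: leq_trans (find_size _ _) _; rewrite size_iota.
Qed.

Lemma before_hit w g n j : (j < hit w g n)%N -> g j <= rnd j w.
Proof.
move=> jh; have jn : (j < n)%N by exact: leq_trans (hit_le w g n).
rewrite hitE in jh; have /negbT := before_find 0%N jh.
by rewrite nth_iota// add0n -leNgt.
Qed.

Lemma at_hit w g n : (hit w g n < n)%N -> rnd (hit w g n) w < g (hit w g n).
Proof.
move=> hn; move: (hn); rewrite {1}hitE -[X in (_ < X)%N](size_iota 0) -has_find.
by move=> /(nth_find 0%N); rewrite -hitE nth_iota.
Qed.

Lemma hit_le_at w g n j : (j < n)%N -> rnd j w < g j -> (hit w g n <= j)%N.
Proof.
by move=> jn; apply: contraTT; rewrite -ltnNge -leNgt; exact: before_hit.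
Qed.

Lemma hit_widen w g n n' : (n <= n')%N -> (hit w g n < n)%N ->
  hit w g n' = hit w g n.
Proof.
move=> nn' hn; apply/eqP; rewrite eqn_leq; apply/andP; split.
  by apply: hit_le_at (at_hit hn); exact: leq_trans hn nn'.
rewrite leqNgt; apply/negP => h.
have := before_hit h; rewrite leNgt => /negP; apply.
by apply: at_hit; apply: leq_trans h _; apply: leq_trans (ltnW hn) nn'.
Qed.

Lemma measurable_hit_neq g h n : measurable [set w | hit w g n <> hit w h n].
Proof.
have := measurable_answers
  (fun s => find id (nth [::] s 0) <> find id (nth [::] s 1))
  [:: [seq (j, g j) | j <- iota 0 n]; [seq (j, h j) | j <- iota 0 n]].
by [].
Qed.

(** At the smaller hit, [rnd] lies between the two thresholds; at every earlier index it is below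
    neither. *)
Lemma hit_lt_first_hit w g h n : (hit w g n < hit w h n)%N ->
  exists2 j, (j < n)%N &
    first_hit (fun i => Num.max (g i) (h i)) j
      (Num.min (g j) (h j)) (Num.max (g j) (h j)) w.
Proof.
move=> lt; have hn : (hit w g n < n)%N by exact: leq_trans lt (hit_le w h n).
exists (hit w g n) => //; split.
  move=> i hi; rewrite ge_max (before_hit hi).
  exact: before_hit (ltn_trans hi lt).
by rewrite ge_min lt_max (before_hit lt) (at_hit hn) orbT.
Qed.

(** Union bound over the first index that tells [g] and [h] apart. Its gap is at most [K] times the
    term that [hit_sum_le] sums to at most 3. *)
Lemma coin_hit_neq g h n (K : R) : 0 <= K ->
  (forall j, 0 <= g j <= 1) -> (forall j, 0 <= h j <= 1) ->
  (forall j, (j < n)%N ->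
     `|g j - h j| <= K * (Num.max (g j) (h j) + slack R j)) ->
  (coin R [set w | hit w g n <> hit w h n] <= (3 * K)%:E)%E.
Proof.
move=> K0 g01 h01 gh.
pose m j := Num.max (g j) (h j).
pose l j := Num.min (g j) (h j).
have m01 j : 0 <= m j <= 1.
  have /andP[g0 g1] := g01 j; have /andP[h0 h1] := h01 j.
  by rewrite le_max ge_max g0 g1 h1.
have lm j : 0 <= l j <= m j.
  have /andP[g0 g1] := g01 j; have /andP[h0 h1] := h01 j.
  by rewrite le_min g0 h0 le_max ge_min lexx.
have mlE j : m j - l j = `|g j - h j|.
  rewrite /m /l minElt maxElt; case: ifP => gj.
    by rewrite ltr0_norm ?subr_lt0// opprB.
  by rewrite ger0_norm// subr_ge0 leNgt gj.
apply: (@le_trans _ _ (coin R (\big[setU/set0]_(j < n) first_hit m j (l j) (m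
  j)))).
  apply: le_measure; rewrite ?inE.
  - exact: measurable_hit_neq.
  - by apply: bigsetU_measurable => j _; exact: measurable_first_hit.
  move=> w /= neq; rewrite -(bigcup_mkord n (fun j => first_hit m j (l j) (m
    j))).
  have [/hit_lt_first_hit[j jn hj]|/hit_lt_first_hit[j jn hj]|//] :=
    ltngtP (hit w g n) (hit w h n); exists j => //.
  case: hj => h1 h2; split; first by move=> i /h1; rewrite /m maxC.
  by rewrite /m /l minC maxC.
have Bo := @Boole_inequality _ _ _ (coin R) (fun j => first_hit m j (l j) (m
  j)) n.
apply: (le_trans (Bo _)) => [j _|]; first exact: measurable_first_hit.
apply: (@le_trans _ _ (\sum_(j < n) (K * (\prod_(i < j) (1 - m i + slack R i) *
  (m j + slack R j)))%:E)%E).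
  apply: lee_sum => j _; apply: (le_trans (coin_first_hit j m01 (lm j))).
  rewrite lee_fin mulrCA; apply: ler_wpM2l; last by rewrite mlE; exact: gh.
  by rewrite prodr_ge0// => i _; have /andP[_ ?] := m01 i;
     rewrite addr_ge0 ?subr_ge0// ltW ?slack_gt0.
by rewrite sumEFin lee_fin -mulr_sumr mulrC ler_wpM2r// hit_sum_le.
Qed.

Definition capture (s : R) (dist : nat -> R) (n : nat) w : nat :=
  hit w (fun j => threshold j (dist j / s)) n.

Lemma rate_mono i j : (i <= j)%N -> rate i <= rate j.
Proof.
move=> ij; rewrite ler_ln ?posrE ?ltr0n ?radix_gt0// ler_nat /radix.
by rewrite leq_mul// leq_mul.
Qed.

(** The relative Lipschitz bound provides [K = rate n * d / s] in [coin_hit_neq], as [rate n] is the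
    largest rate among the indices up to [n]. *)
Lemma coin_capture_neq (s d : R) (dx dy : nat -> R) n :
  0 < s -> (forall j, `|dx j - dy j| <= d) ->
  (coin R [set w | capture s dx n.+1 w <> capture s dy n.+1 w]
     <= (3 * rate n * d / s)%:E)%E.
Proof.
move=> s0 hd.
have d0 : 0 <= d by apply: le_trans (hd 0%N).
rewrite -!mulrA; apply: coin_hit_neq.
- by rewrite mulr_ge0 ?rate_ge0// divr_ge0// ltW.
- by move=> j; rewrite threshold_ge0 threshold_le1.
- by move=> j; rewrite threshold_ge0 threshold_le1.
move=> j jn.
wlog xy : dx dy hd / dx j <= dy j.
  move=> H; have [/H|/ltW/H] := leP (dx j) (dy j); first by apply.
  by rewrite distrC maxC; apply => i; rewrite distrC.
have xys : dx j / s <= dy j / s by rewrite ler_wpM2r// invr_ge0 ltW.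
have tm := threshold_mono j xys.
rewrite ger0_norm ?subr_ge0// max_l//.
apply: le_trans (threshold_lipschitz j xys) _.
apply: ler_wpM2r; first by rewrite addr_ge0 ?threshold_ge0// ltW ?slack_gt0.
rewrite -mulrBl; apply: ler_pM; rewrite ?rate_ge0// ?rate_mono//.
  by rewrite mulr_ge0 ?subr_ge0// invr_ge0 ltW.
rewrite ler_wpM2r ?invr_ge0 ?(ltW s0)//.
by apply: le_trans (hd j); rewrite distrC ler_norm.
Qed.

Lemma capture_near s dist n w j : (j < n)%N -> dist j <= s -> 0 < s ->
  (capture s dist n w <= j)%N.
Proof.
move=> jn ds s0; apply: hit_le_at => //.
by rewrite threshold_near ?ler_pdivrMr ?mul1r// rnd_lt1.
Qed.

Lemma capture_close s dist n w : 0 < s -> (capture s dist n w < n)%N ->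
  dist (capture s dist n w) <= 3 * s.
Proof.
move=> s0 /at_hit; rewrite -/(capture s dist n w) => h.
rewrite leNgt; apply/negP => far; move: h.
rewrite threshold_far; first by rewrite ltNge rnd_ge0.
by rewrite ler_pdivlMr// ltW.
Qed.

End Thresholds.

(** The integral of the nonnegative [X] is a supremum over simple functions below it; each of them
    lies below the measurable bound [Y], whose integral is computed by linearity. *)
Lemma expectation_le_indic (R : realType) (d : measure_display)
    (T : measurableType d) (P : probability T R) (X : T -> R) (I : Type)
    (s : seq I) (B : I -> set T) (c p : I -> R) (c0 : R) :
  0 <= c0 -> (forall w, 0 <= X w) -> (forall i, measurable (B i)) ->
  (forall i, 0 <= c i) -> (forall i, (P (B i) <= (p i)%:E)%E) ->
  (forall w, X w <= c0 + \sum_(i <- s) c i * \1_(B i) w) ->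
  ('E_P[X] <= (c0 + \sum_(i <- s) c i * p i)%:E)%E.
Proof.
move=> c00 X0 mB c_ge0 PB XB.
pose Y w := ((c0)%:E + \sum_(i <- s) (c i * \1_(B i) w)%:E)%E.
have Y0 i w : (0 <= (c i * \1_(B i) w)%:E)%E by rewrite lee_fin mulr_ge0.
have mi i : measurable_fun setT (fun w => (c i * \1_(B i) w)%:E).
  by apply/measurable_EFinP; apply: measurable_funM => //; exact:
    measurable_indic.
have mY : measurable_fun setT Y.
  by apply: emeasurable_funD => //; apply: emeasurable_sum.
apply: (@le_trans _ _ (\int[P]_w Y w)%E).
  rewrite unlock ge0_integralTE; last by move=> w; rewrite lee_fin.
  apply: ge_ereal_sup => _ /= [h hX <-].
  rewrite -integralT_nnsfun; apply: ge0_le_integral => //=.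
  - by move=> w _; rewrite lee_fin; exact: fun_ge0.
  - exact/measurable_EFinP.
  - move=> w _; apply: le_trans (hX w) _.
    by rewrite /Y sumEFin -EFinD lee_fin.
rewrite ge0_integralD//; last 2 first.
  - by move=> w _; apply: sume_ge0.
  - by apply: emeasurable_sum.
rewrite integral_cst//= probability_setT mule1 EFinD leeD2l//.
rewrite ge0_integral_sum// -sumEFin; apply: lee_sum => i _.
under eq_integral do rewrite EFinM.
rewrite ge0_integralZl_EFin//; last first.
  by apply/measurable_EFinP; exact: measurable_indic.
rewrite integral_indic// setIT EFinM; apply: lee_wpmul2l;
  rewrite ?lee_fin//. exact: PB.
Qed.

(** * The algorithm *)

Section Algorithm.
Context (R : realType).

Definition dyad (e : int) : R := 2 ^ e.

Definition log2_ceil (x : R) : int := Num.ceil (ln x / ln 2).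

Lemma ln2_gt0 : 0 < ln 2 :> R.
Proof. by rewrite ln_gt0// ltr1n. Qed.

Lemma dyad_gt0 e : 0 < dyad e.
Proof. by rewrite exprz_gt0. Qed.

Lemma dyadD e e' : dyad (e + e') = dyad e * dyad e'.
Proof. by rewrite /dyad expfzDr// pnatr_eq0. Qed.

Lemma dyadB e n : dyad (e - n%:Z) = dyad e / 2 ^+ n.
Proof. by rewrite dyadD /dyad -exprnN. Qed.

Lemma ln_dyad e : ln (dyad e) = e%:~R * ln 2.
Proof.
rewrite /dyad; case: e => n; first by rewrite -exprnP lnXn// mulr_natl.
by rewrite NegzE -exprnN lnV ?posrE ?exprn_gt0// lnXn// mulrNz mulNr mulr_natl.
Qed.

Lemma dyad_log2_ceil x : 0 < x -> x <= dyad (log2_ceil x) <= 2 * x.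
Proof.
move=> x0; have l2 := ln2_gt0.
have /andP[h1 h2] := ceil_itv (ln x / ln 2).
apply/andP; split.
  rewrite -ler_ln ?posrE ?dyad_gt0// ln_dyad -ler_pdivrMr//.
rewrite -ler_ln ?posrE ?dyad_gt0 ?mulr_gt0// ln_dyad lnM ?posrE//.
move: h1; rewrite -/(log2_ceil x) ltr_pdivlMr// intrD mulrN1z => h1; lra.
Qed.

Lemma log2_ceil_mono x y : 0 < x -> x <= y -> log2_ceil x <= log2_ceil y.
Proof.
move=> x0 xy; apply: le_ceil; rewrite ler_wpM2r ?invr_ge0 ?(ltW ln2_gt0)//.
by rewrite ler_ln ?posrE// (lt_le_trans x0).
Qed.

(* Repeated points are represented by their first occurrence, so that sequences
   of distinct indices are sequences of distinct points. *)
Definition canon n (D : 'M[R]_n.+1) (i : 'I_n.+1) : 'I_n.+1 :=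
  [arg min_(a < i | D a i == 0%R) (a : nat)]%N.

(* Radii are powers of 2, not multiples of the distance to the root, so that all
   the terminals use the same clusterings. *)
Definition radius n (D : 'M[R]_n.+1) (j : nat) : R :=
  dyad (log2_ceil (D ord0 ord_max) - n%:Z + j%:Z).

Definition queries n (D : 'M[R]_n.+1) : seq (seq (nat * R)) :=
  [seq [seq (i, threshold i (D (inord i) ord_max / radius D j))
       | i <- iota 0 n.+1] | j <- iota 0 n].

Definition centers n (bss : seq (seq bool)) : seq 'I_n.+1 :=
  [seq inord (find id bs) | bs <- bss].

Definition walk n (D : 'M[R]_n.+1) (bss : seq (seq bool)) : seq 'I_n.+1 :=
  [seq canon D i | i <- rcons (centers n bss) ord0].

Definition algorithm (w : R) : online_algorithm R := fun n D =>
  canon D ord_max ::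
    shorten (canon D ord_max) (walk D (answers w (queries D))).

Lemma measurable_algorithm n (D : 'M[R]_n.+1) (p : seq 'I_n.+1) :
  measurable [set w | algorithm w D = p].
Proof.
exact: (measurable_answers (fun bss =>
  canon D ord_max :: shorten (canon D ord_max) (walk D bss) = p)).
Qed.

(** Fed to [shortenP], this relation shows that cutting the loops of a walk creates no new hop. *)
Lemma path_zip (T : eqType) (x : T) (p : seq T) :
  path [rel a b | (a, b) \in zip (x :: p) p] x p.
Proof.
suff h (S : seq (T * T)) : {subset zip (x :: p) p <= S} ->
  path [rel a b | (a, b) \in S] x p by exact: h.
elim: p x => [//|y p ih] x hS /=; rewrite hS ?mem_head//=.
by apply: ih => e he; apply: hS; rewrite /= in_cons he orbT.
Qed.

Lemma mem_zip_path (T : eqType) (e : rel T) (x : T) (p : seq T) a b :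
  path e x p -> (a, b) \in zip (x :: p) p -> e a b.
Proof.
elim: p x => [//|y p ih] x /= /andP[exy pp].
by rewrite in_cons => /orP[/eqP[-> ->]//|]; exact: ih.
Qed.

Lemma zip_map2 (T T' : Type) (f : T -> T') (s s' : seq T) :
  zip (map f s) (map f s') = [seq (f e.1, f e.2) | e <- zip s s'].
Proof. by elim: s s' => [|a s ih] [|b s'] //=; rewrite ih. Qed.

Lemma mem_zip_map_iota (T : eqType) (f : nat -> T) (a : T) m l e :
  e \in zip (a :: map f (iota m l)) (map f (iota m l)) ->
  e = (a, f m) \/ exists2 j, (m <= j)%N && (j.+1 < m + l)%N & e = (f j, f j.+1).
Proof.
elim: l m a => [//|l ih] m a; rewrite /= in_cons => /orP[/eqP->|];
  first by left.
case: l ih => [//|l] ih /ih[->|[j jl ->]]; right.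
  by exists m => //; rewrite leqnn; lia.
by exists j => //; lia.
Qed.

Section Execution.
Context (V : metricType R) (k : nat) (r : V) (t : k.-tuple V).
Local Notation pt := (Defs.point r t).

Lemma revealedE n (a b : 'I_n.+1) : revealed r t n a b = mdist (pt a) (pt b).
Proof. by rewrite mxE. Qed.

Lemma mdist_eq0 (x y : V) : (mdist x y == 0) = (x == y).
Proof.
by apply/eqP/eqP => [/mdist_positivity//|->]; rewrite mdistxx.
Qed.

Lemma point_canon n (i : 'I_n.+1) : pt (canon (revealed r t n) i) = pt i.
Proof.
rewrite /canon; case: arg_minnP; first by rewrite revealedE mdistxx.
by move=> a; rewrite revealedE mdist_eq0 => /eqP.
Qed.

Lemma canon_inj n (i j : 'I_n.+1) : pt i = pt j ->
  canon (revealed r t n) i = canon (revealed r t n) j.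
Proof.
move=> ij; rewrite /canon.
case: arg_minnP => [|a]; first by rewrite revealedE mdistxx.
rewrite revealedE ij => ha mina.
case: arg_minnP => [|b]; first by rewrite revealedE mdistxx.
rewrite revealedE => hb minb; apply/val_inj/eqP; rewrite eqn_leq.
by rewrite mina ?minb// !revealedE ?ij.
Qed.

Lemma canonK n (i : 'I_n.+1) :
  canon (revealed r t n) (canon (revealed r t n) i) = canon (revealed r t n) i.
Proof. by apply: canon_inj; rewrite point_canon. Qed.

Lemma algorithm_is_path w n :
  is_path (pt n) r [seq pt (val j) | j <- algorithm w (revealed r t n)].
Proof.
rewrite /algorithm; set D := revealed r t n.
set p := walk D _; set x := canon D ord_max.
have last_p : pt (last x p) = r.
  by rewrite /p /walk map_rcons last_rcons point_canon.
have cp i : i \in x :: p -> canon D i = i.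
  by rewrite in_cons => /orP[/eqP->|/mapP[j _ ->]]; exact: canonK.
move: last_p; case: (shortenP (path_zip x p)) => p' _ up' sp' last_p /=.
rewrite (last_map (fun j : 'I_n.+1 => pt j)) last_p eqxx (_ :
  pt x == pt n) /=; last first.
  by apply/eqP; exact: point_canon.
rewrite -[_ && _]/(uniq (map (fun j : 'I_n.+1 => pt j) (x ::
  p'))) map_inj_in_uniq// => a b ha hb ab.
have sub i : i \in x :: p' -> i \in x :: p.
  by rewrite !in_cons => /orP[->//|/sp' ->]; rewrite orbT.
by rewrite -(cp a (sub a ha)) -(cp b (sub b hb)); exact: canon_inj.
Qed.

(* The index of the center of [x], or [k.+1] if no point captures [x]. *)
Definition center_of (e : int) (w : R) (x : V) : nat :=
  capture (dyad e) (fun j => mdist (pt j) x) k.+1 w.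

Lemma center_of_le e w x : (center_of e w x <= k.+1)%N.
Proof. exact: hit_le. Qed.

Lemma center_of_le_index e w n : (n <= k)%N -> (center_of e w (pt n) <= n)%N.
Proof.
by move=> nk; apply: capture_near; rewrite ?dyad_gt0// mdistxx ltW ?dyad_gt0.
Qed.

Lemma mdist_center_of e w n : (n <= k)%N ->
  mdist (pt (center_of e w (pt n))) (pt n) <= 3 * dyad e.
Proof.
move=> nk; apply: (@capture_close _ (dyad e) (fun j => mdist (pt j) (pt n))
  k.+1 w).
  exact: dyad_gt0.
by rewrite ltnS; apply: leq_trans (center_of_le_index e w nk) nk.
Qed.

Lemma center_of_eq0 e w x : mdist r x <= dyad e -> center_of e w x = 0%N.
Proof.
by move=> rx; apply/eqP; rewrite -leqn0; apply: capture_near => //; exact: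
  dyad_gt0.
Qed.

Lemma eq_hit w (g h : nat -> R) n :
  (forall j, (j < n)%N -> g j = h j) -> hit w g n = hit w h n.
Proof.
move=> gh; rewrite !hitE; apply: eq_in_find => j;
  rewrite mem_iota => /andP[_ jn].
by rewrite gh.
Qed.

(** The terminal captures itself, so some known point is hit, and later arrivals do not change the
    hit: the online choice is the center among all [k.+1] points. *)
Lemma point_center w n j : (n <= k)%N ->
  let D := revealed r t n in
  pt (inord (hit w (fun i =>
        threshold i (D (inord i) ord_max / radius D j)) n.+1) : 'I_n.+1) =
  pt (center_of (log2_ceil (mdist r (pt n)) - n%:Z + j%:Z) w (pt n)).
Proof.
move=> nk D; set e := _ + j%:Z.
have hn : (capture (dyad e) (fun j => mdist (pt j) (pt n)) n.+1 w < n.+1)%N.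
  by rewrite ltnS; apply: capture_near; rewrite ?dyad_gt0// mdistxx ltW
    ?dyad_gt0.
have -> : hit w (fun i => threshold i (D (inord i) ord_max / radius D j)) n.+1 =
    capture (dyad e) (fun j => mdist (pt j) (pt n)) n.+1 w.
  apply: eq_hit => i; rewrite ltnS => i_n.
  by rewrite /radius !revealedE /= inordK.
by rewrite inordK// /center_of; congr pt; symmetry; exact:
  (hit_widen (n' := k.+1)).
Qed.

Lemma algorithm_hop w n x y : (n <= k)%N ->
  uses [seq pt (val j) | j <- algorithm w (revealed r t n)] x y ->
  let c (j : nat) :=
    pt (center_of (log2_ceil (mdist r (pt n)) - n%:Z + j%:Z) w (pt n)) in
  exists2 e, (e == (x, y)) || (e == (y, x)) &
    e = (pt n, c 0%N) \/ exists2 j, (j < n)%N & e = (c j, c j.+1).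
Proof.
move=> nk; set D := revealed r t n; move=> uxy c.
pose W := [seq c j | j <- iota 0 n.+1].
have eW : [seq pt (val i) | i <- rcons (centers n (answers w (queries D)))
  ord0] = W.
  rewrite map_rcons /W -[X in iota 0 X]addn1 iotaD map_cat cats1;
    congr (rcons _ _).
    rewrite -!map_comp; apply/eq_in_map => j _ /=.
    exact: point_center.
  (* The last entry of [W] is at the top scale, whose radius reaches [r]. For a terminal at [r],
     [log2_ceil] is taken at 0 and says nothing, but any radius will do. *)
  rewrite /c add0n subrK center_of_eq0//.
  have [rn|rn] := eqVneq r (pt n).
    by rewrite -rn mdistxx ltW// dyad_gt0.
  by have /andP[] : mdist r (pt n) <= dyad (log2_ceil (mdist r (pt n)))
    <= 2 * mdist r (pt n) by apply: dyad_log2_ceil; rewrite mdist_gt0.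
have hop a b : (a, b) \in zip (algorithm w D) (behead (algorithm w D)) ->
    (pt a, pt b) \in zip (pt n :: W) W.
  rewrite /algorithm; set p := walk D _; set x0 := canon D ord_max.
  case: (shortenP (path_zip x0 p)) => p' pp' _ _ /(mem_zip_path pp') ab.
  have -> : pt n :: W = [seq pt (val i) | i <- x0 :: p].
    rewrite /= point_canon /p /walk -map_comp -eW; congr (_ :: _).
    by apply: eq_map => i /=; rewrite point_canon.
  have -> : W = [seq pt (val i) | i <- p].
    rewrite -eW /p /walk -map_comp.
    by apply: eq_map => i /=; rewrite point_canon.
  rewrite zip_map2; exact: (map_f (fun e => (pt (val e.1), pt (val e.2))) ab).
have hop' a b : (a, b) \in zip [seq pt (val j) | j <- algorithm w D]
    (behead [seq pt (val j) | j <- algorithm w D]) ->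
    (a, b) = (pt n, c 0%N) \/ exists2 j, (j < n)%N & (a, b) = (c j, c j.+1).
  rewrite behead_map zip_map2 => /mapP[[a' b'] /hop h [-> ->]].
  by have [->|[j jn ->]] := mem_zip_map_iota h; [left|right; exists j].
case/orP: uxy => /hop' h; [exists (x, y)|exists (y, x)] => //;
  by rewrite eqxx ?orbT.
Qed.

End Execution.
End Algorithm.

(** * Expected cost *)

Section Analysis.
Context (R : realType) (V : metricType R) (k : nat) (r : V) (t : k.-tuple V).
Context (f : R -> R) (hf : cost_function f).
Local Notation pt := (Defs.point r t).
Local Notation term := (tnth t).
Local Notation cl := (center_of r t).

Lemma point_tnth (i : 'I_k) : pt i.+1 = term i.
Proof. by rewrite /Defs.point /= (tnth_nth r). Qed.

Lemma cost_function_nat_le n : f n%:R <= n%:R * f 1.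
Proof.
have := cost_function_sum (iota 0 n) predT (fun=> 1%N) hf.
by rewrite !big_const_seq/= count_predT size_iota iter_addn_0 mul1n iter_addr_0
  mulr_natl.
Qed.

(** Terminals with equal labels make the same hop between the scales [e] and [e + 1]. The size
    [k.+2] leaves room for the value [k.+1] of uncaptured points. *)
Definition label (e : int) (w : R) (x : V) : 'I_k.+2 * 'I_k.+2 :=
  (inord (cl e w x), inord (cl (e + 1) w x)).

Lemma val_label1 e w x : val (label e w x).1 = cl e w x.
Proof. by rewrite /= inordK// ltnS center_of_le. Qed.

Lemma val_label2 e w x : val (label e w x).2 = cl (e + 1) w x.
Proof. by rewrite /= inordK// ltnS center_of_le. Qed.

Lemma label_root e w : label e w r = (ord0, ord0).
Proof.
rewrite /label !center_of_eq0 ?mdistxx ?ltW ?dyad_gt0//.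
by congr pair; apply/val_inj; rewrite /= inordK.
Qed.

Lemma measurable_label_neq e x y :
  measurable [set w | label e w x != label e w y].
Proof.
have -> : [set w | label e w x != label e w y] =
    [set w | cl e w x <> cl e w y] `|`
    [set w | cl (e + 1) w x <> cl (e + 1) w y].
  apply/seteqP; split => w /=.
    apply: contraNP => /not_orP[/contrapT h1 /contrapT h2].
    by rewrite /label h1 h2.
  move=> h; apply/eqP => lxy; case: h; apply.
    by rewrite -!val_label1 lxy.
  by rewrite -!val_label2 lxy.
by apply: measurableU; exact: measurable_hit_neq.
Qed.

(** The constant is [3 + 3 / 2], from a union bound over the scales [e] and [e + 1]. *)
Lemma coin_label_neq e x y :
  (coin R [set w | label e w x != label e w y]
     <= (9 / 2 * rate R k * mdist x y / dyad R e)%:E)%E.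
Proof.
have hd j : `|mdist (pt j) x - mdist (pt j) y| <= mdist x y.
  have := metric_triangle (pt j) x y; have := metric_triangle (pt j) y x.
  by rewrite (metric_sym y x) ler_norml; lra.
have h e' := coin_capture_neq k (dyad_gt0 R e') hd.
apply: (@le_trans _ _ (coin R ([set w | cl e w x <> cl e w y] `|`
    [set w | cl (e + 1) w x <> cl (e + 1) w y]))).
  apply: le_measure; rewrite ?inE.
  - exact: measurable_label_neq.
  - by apply: measurableU; exact: measurable_hit_neq.
  move=> w /=; apply: contraNP => /not_orP[/contrapT h1 /contrapT h2].
  by rewrite /label h1 h2.
apply: le_trans (measureU2 _ _ _) _; try exact: measurable_hit_neq.
apply: le_trans (leeD (h e) (h (e + 1))) _.
rewrite -EFinD lee_fin dyadD /dyad expr1z -/(dyad R e) invfM.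
by rewrite le_eqVlt; apply/orP; left; apply/eqP; field;
  rewrite gt_eqF ?dyad_gt0.
Qed.

(** In [cost_le_labels], the first hop of each terminal gets its own label; any other hop is
    labelled by its scale, counted down from [top - 1], and its pair of centers. [A] counts enough
    scales to reach the lowest one. *)
Lemma cost_algorithm_le w (A : nat) (top : int) :
  (forall i, r != term i -> log2_ceil (mdist r (term i)) <= top) ->
  (forall i : 'I_k, r != term i ->
     (absz (top - log2_ceil (mdist r (term i)) + i.+1%:Z)%R <= A)%N) ->
  cost f (run (algorithm w) r t) <=
    \sum_i mdist (term i)
        (pt (cl (log2_ceil (mdist r (term i)) - i.+1%:Z) w (term i))) * f 1 +
    \sum_(0 <= a < A) \sum_(c : 'I_k.+2 * 'I_k.+2)
        mdist (pt c.1) (pt c.2) *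
        f #|[pred i | label (top - 1 - a%:Z) w (term i) == c]|%:R.
Proof.
move=> htop hA.
pose L : finType := ('I_k + 'I_A * ('I_k.+2 * 'I_k.+2))%type.
pose E (l : L) : V * V := match l with
  | inl i =>
    (term i, pt (cl (log2_ceil (mdist r (term i)) - i.+1%:Z) w (term i)))
  | inr (_, c) => (pt c.1, pt c.2) end.
pose B (l : L) : pred 'I_k := match l with
  | inl i => pred1 i
  | inr (a, c) => [pred i | label (top - 1 - a%:Z) w (term i) == c] end.
have := @cost_le_labels R V k f (run (algorithm w) r t) L B E hf.
rewrite big_sumType/= => h; apply: le_trans (h _) _; last first.
  rewrite lerD//; first by apply: ler_sum => i _; rewrite card1.
  rewrite big_mkord pair_bigA/=.
  by rewrite le_eqVlt; apply/orP; left; apply/eqP; apply: eq_bigr => -[].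
move=> i x y uxy xy.
have [e exy] := algorithm_hop (ltn_ord i) uxy.
rewrite point_tnth; case=> [e0|[j ji ej]].
  exists (inl i); first exact: eqxx.
  by have -> : E (inl i) = e by rewrite e0 addr0.
(* All centers of a terminal at [r] are [r], so it makes no hop between distinct points. *)
have [rt|rt] := eqVneq r (term i).
  exfalso; move: ej exy xy.
  rewrite !center_of_eq0 -?rt ?mdistxx ?ltW ?dyad_gt0// => ->.
  by case/orP => /eqP[<- <-]; rewrite eqxx.
have htopi := htop i rt; have hAi := hA i rt.
set T := log2_ceil _ in ej htopi hAi.
pose a := absz (top - 1 - (T - i.+1%:Z + j%:Z))%R.
have ea : top - 1 - a%:Z = T - i.+1%:Z + j%:Z by rewrite /a; lia.
have aA : (a < A)%N by rewrite /a; lia.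
set l : L := inr (Ordinal aA, label (top - 1 - a%:Z) w (term i)).
exists l; first exact: eqxx.
have ea1 : top - 1 - a%:Z + 1 = T - i.+1%:Z + j.+1%:Z by rewrite ea; lia.
have -> // : E l = e.
by rewrite ej -ea1 -ea -(val_label1 _ w) -(val_label2 _ w).
Qed.

(** Both centers lie near a common terminal, within [3 * 2 ^ e] and [3 * 2 ^ (e + 1)], hence the 9.
    The class of [r] hops from [r] to [r] for free. *)
Lemma scale_cost_le e w :
  \sum_(c : 'I_k.+2 * 'I_k.+2) mdist (pt c.1) (pt c.2) *
      f #|[pred i | label e w (term i) == c]|%:R <=
  9 * dyad R e * \sum_(c | c != label e w r)
      f #|[pred i | label e w (term i) == c]|%:R.
Proof.
have [f0 fge0 _ _] := hf; have s0 := dyad_gt0 R e.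
rewrite mulr_sumr [X in _ <= X]big_mkcond/=; apply: ler_sum => c _.
case: ifPn => [_|]; last by rewrite negbK => /eqP->;
  rewrite label_root mdistxx mul0r.
have [n0|/card_gt0P[i]] := posnP #|[pred i | label e w (term i) == c]|.
  by rewrite n0 f0 !mulr0.
rewrite inE => /eqP lc; rewrite ler_wpM2r ?fge0//.
apply: le_trans (metric_triangle _ (term i) _) _.
rewrite -lc (metric_sym (term i)) val_label1 val_label2 -point_tnth.
have h e' := mdist_center_of r t e' w (ltn_ord i).
have := h e; have := h (e + 1); rewrite dyadD /dyad expr1z -/(dyad R e); lra.
Qed.

(** Meant for the small scales, where the geometric decay of the radii makes up for the factor
    [k]. *)
Lemma label_cost_trivial e w :
  \sum_(c | c != label e w r) f #|[pred i | label e w (term i) == c]|%:R <=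
  k%:R * f 1.
Proof.
have [f0 fge0 _ _] := hf.
apply: le_trans (_ : \sum_c \sum_(i | label e w (term i) == c) f 1 <= _).
  rewrite big_mkcond/=; apply: ler_sum => c _; rewrite sumr_const.
  case: ifP => _; last by rewrite mulrn_wge0// fge0.
  rewrite -[X in _ <= X]mulr_natl; apply: le_trans (cost_function_nat_le _) _.
  by rewrite ler_wpM2r ?fge0// ler_nat; apply/eq_leq/eq_card => i.
have <- : \sum_(i < k) f 1 = \sum_c \sum_(i | label e w (term i) == c) f 1.
  by rewrite (partition_big (fun i => label e w (term i)) predT).
by rewrite sumr_const card_ord -[X in X <= _]mulr_natl.
Qed.

Definition pairs (Q : 'I_k -> seq V) : seq (V * V) :=
  [seq (x, y) | x <- vertices Q, y <- vertices Q].

Lemma label_cost_cut Q e w : is_routing r t Q ->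
  \sum_(c | c != label e w r) f #|[pred i | label e w (term i) == c]|%:R <=
  \sum_(p <- pairs Q)
     f (load Q p.1 p.2)%:R * \1_[set w | label e w p.1 != label e w p.2] w.
Proof.
move=> hQ; apply: le_trans (cut_cost (label e w) hf hQ) _.
rewrite big_allpairs/=; apply: ler_sum => x _; apply: ler_sum => y _.
rewrite indicE; case: ifPn => h; first by rewrite mem_set// mulr1.
by rewrite memNset ?mulr0//=; exact/negP.
Qed.

End Analysis.

Lemma geometric_sum_le (R : realType) (n : nat) :
  \sum_(0 <= i < n) (2 ^+ i)^-1 <= 2 :> R.
Proof.
suff -> : \sum_(0 <= i < n) (2 ^+ i)^-1 = 2 - 2 / 2 ^+ n :> R.
  by rewrite gerBl divr_ge0// exprn_ge0.
elim: n => [|n ih]; first by rewrite big_nil expr0 divr1 subrr.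
rewrite big_nat_recr//= ih exprS; field.
by rewrite expf_neq0.
Qed.

Lemma ln2_ge (R : realType) : 2^-1 <= ln 2 :> R.
Proof.
have h := expR_ge1Dx (- 2^-1 : R).
rewrite -ler_expR lnK ?posrE// -[X in X <= _]invrK -expRN.
by rewrite -[X in _ <= X]invrK lef_pV2 ?posrE ?invr_gt0 ?expR_gt0//; lra.
Qed.

(** As [ln 2 >= 1 / 2], both the truncated logarithm and 1 are at most [2 * ln k]. *)
Lemma trunc_log2_le (R : realType) (k : nat) : (2 <= k)%N ->
  (trunc_log 2 k).+1%:R <= 4 * ln k%:R :> R.
Proof.
move=> k2; have l2 := ln2_ge R.
have hk : ln 2 <= ln k%:R :> R by rewrite ler_ln ?posrE ?ltr0n ?ler_nat//; lia.
have hT : (trunc_log 2 k)%:R * ln 2 <= ln k%:R :> R.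
  rewrite mulr_natl -lnXn// ler_ln ?posrE ?exprn_gt0 ?ltr0n//; try lia.
  by rewrite -natrX ler_nat trunc_logP//; lia.
rewrite -natr1; have T0 : 0 <= (trunc_log 2 k)%:R :> R by [].
nra.
Qed.

Lemma rate_le (R : realType) (k : nat) : (2 <= k)%N ->
  rate R k <= 5 * ln k%:R.
Proof.
move=> k2; have k0 : 0 < k%:R :> R by rewrite ltr0n; lia.
rewrite /rate mulr_natl -lnXn// ler_ln ?posrE ?(exprn_gt0 _ k0) ?ltr0n
  ?radix_gt0//.
rewrite -natrX ler_nat /radix.
(* For [k >= 2], [radix k] is at most [8 * k ^ 2]. *)
have : (8 * k ^ 2 <= k ^ 5)%N by rewrite (expnD k 3 2) leq_mul2r (leq_exp2r 2 k
  (e := 3))// k2 orbT.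
nia.
Qed.

Section ExpectedCost.
Context (R : realType) (V : metricType R) (k : nat) (r : V) (t : k.-tuple V).
Context (f : R -> R) (hf : cost_function f) (k_ge2 : (2 <= k)%N).
Context (Q : 'I_k -> seq V) (hQ : is_routing r t Q).
Local Notation term := (tnth t).

Lemma farthest_terminal : exists i0, forall i : 'I_k,
  mdist r (term i) <= mdist r (term i0).
Proof.
have i1 : 'I_k by exists 0%N; lia.
have [i0 _ h] := arg_maxP (fun i => mdist r (term i)) (isT : predT i1).
by exists i0 => i; exact: h.
Qed.

Definition scale_set (top : int) (q : nat * (V * V)) : set R :=
  [set w | label r t (top - 1 - q.1%:Z) w q.2.1 !=
           label r t (top - 1 - q.1%:Z) w q.2.2].

Definition scale_weight (top : int) (q : nat * (V * V)) : R :=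
  9 * dyad R (top - 1 - q.1%:Z) * f (load Q q.2.1 q.2.2)%:R.

Definition scales : seq (nat * (V * V)) :=
  [seq (a, p) | a <- index_iota 0 (trunc_log 2 k).+1, p <- pairs Q].

Lemma scale_weight_ge0 top q : 0 <= scale_weight top q.
Proof.
by have [_ fge0 _ _] := hf; rewrite !mulr_ge0// ?fge0// ltW ?dyad_gt0.
Qed.

Lemma cost_algorithm_scales (D : R) w : let top := log2_ceil D in
  (forall i, mdist r (term i) <= D) ->
  cost f (run (algorithm w) r t) <=
    24 * (f 1 * D) +
    \sum_(q <- scales) scale_weight top q * \1_(scale_set top q) w.
Proof.
move=> top hD; have [f0 fge0 _ _] := hf.
have f1 : 0 <= f 1 by rewrite fge0.
have D0 : 0 <= D by apply: le_trans (hD (Ordinal k_ge2)); exact: mdist_ge0.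
have S0 : 0 <= \sum_(q <- scales) scale_weight top q * \1_(scale_set top q) w.
  by rewrite sumr_ge0// => q _; rewrite mulr_ge0 ?scale_weight_ge0.
pose lk := (trunc_log 2 k).+1.
pose T i := log2_ceil (mdist r (term i)).
(* If [D = 0], all terminals are at the root and no scale is counted. Otherwise [lk] scales are
   treated by cuts, and the maximum adds enough scales to reach every hop. *)
pose B := (if D == 0%R then 0 else lk + \max_(i < k) absz (top - T i +
  i.+1%:Z)%R)%N.
have pos i : r != term i -> 0 < D.
  by move=> ri; apply: lt_le_trans (hD i); rewrite mdist_gt0.
apply: le_trans (cost_algorithm_le (A := B) (top := top) hf w _ _) _.
- by move=> i ri; apply: log2_ceil_mono; rewrite ?mdist_gt0.
- move=> i ri; rewrite /B gt_eqF ?(pos i ri)//.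
  apply: leq_trans (leq_addl _ _).
  exact: (leq_bigmax (F := fun i : 'I_k => absz (top - T i + i.+1%:Z)%R)).
(* Terminal [i], counted from 0, starts at scale [T i - (i + 1)], so its first hop has length at
   most [3 * D / 2 ^ i]. This summability is why the n-th terminal uses n scales. *)
have first_hops : \sum_i mdist (term i)
    (Defs.point r t (center_of r t (T i - i.+1%:Z) w (term i))) * f 1 <=
    6 * (f 1 * D).
  apply: le_trans (_ : \sum_(i < k) (3 * (f 1 * D)) * (2 ^+ i)^-1 <= _);
    last first.
    rewrite -mulr_sumr -(big_mkord xpredT (fun i => (2 ^+ i)^-1)).
    have := geometric_sum_le R k; have : 0 <= f 1 * D by rewrite mulr_ge0.
    by nra.
  apply: ler_sum => i _.
  rewrite (_ : _ / _ = 3 * D * (2 ^+ i)^-1 * f 1); last by ring.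
  apply: ler_wpM2r => //.
  have e0 : 0 < 2 ^+ i :> R by rewrite exprn_gt0.
  have [ri|ri] := eqVneq r (term i).
    rewrite center_of_eq0 -?ri ?mdistxx ?(ltW (dyad_gt0 _ _))//.
    by rewrite !mulr_ge0// invr_ge0 (ltW e0).
  rewrite metric_sym -(point_tnth r).
  apply: le_trans (mdist_center_of _ _ _ _ (ltn_ord i)) _.
  rewrite dyadB exprS invfM -/(T i).
  rewrite (_ : 3 * _ = 3 * (dyad R (T i) / 2) * (2 ^+ i)^-1); last by ring.
  apply: ler_wpM2r; first by rewrite invr_ge0 ltW.
  have m0 : 0 < mdist r (term i) by rewrite mdist_gt0.
  have /andP[_ h] := dyad_log2_ceil m0.
  by have := hD i; rewrite -/(T i) in h; lra.
have [D_eq0|D_neq0] := eqVneq D 0.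
  have -> : B = 0%N by rewrite /B D_eq0 eqxx.
  rewrite [X in _ + X]big_geq// addr0.
  by apply: le_trans first_hops _; have := mulr_ge0 f1 D0; lra.
have D_gt0 : 0 < D by rewrite lt_neqAle eq_sym D_neq0.
rewrite /B (negbTE D_neq0) (big_cat_nat (n := lk))//= ?leq_addr//.
have head_scales : \sum_(0 <= a < lk) \sum_(c : 'I_k.+2 * 'I_k.+2)
    mdist (Defs.point r t c.1) (Defs.point r t c.2) *
    f #|[pred i | label r t (top - 1 - a%:Z) w (term i) == c]|%:R <=
    \sum_(q <- scales) scale_weight top q * \1_(scale_set top q) w.
  rewrite /scales big_allpairs/=; apply: ler_sum => a _.
  apply: le_trans (scale_cost_le r t hf _ w) _.
  have := label_cost_cut hf (top - 1 - a%:Z) w hQ.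
  move=> /(ler_wpM2l (_ : 0 <= 9 * dyad R (top - 1 - a%:Z))) h.
  apply: le_trans (h _) _; first by rewrite mulr_ge0// ltW ?dyad_gt0.
  rewrite mulr_sumr; apply: ler_sum => p _.
  by rewrite /scale_weight /scale_set /= !mulrA.
(* By [2 ^ top <= 2 * D] and [k <= 2 ^ lk], scale number [lk + b] costs at most
   [9 * f 1 * D / 2 ^ b]. The sum 18 and the 6 of the first hops make 24. *)
have tail_scales m : \sum_(lk <= a < lk + m) \sum_(c : 'I_k.+2 * 'I_k.+2)
    mdist (Defs.point r t c.1) (Defs.point r t c.2) *
    f #|[pred i | label r t (top - 1 - a%:Z) w (term i) == c]|%:R <=
    18 * (f 1 * D).
  rewrite -[X in \sum_(X <= _ < _) _]add0n [X in \sum_(_ <= _ < X) _]addnC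
    big_addn addnK.
  apply: le_trans (_ : \sum_(0 <= b < m) (9 * (f 1 * D)) * (2 ^+ b)^-1 <= _).
    apply: ler_sum => b _.
    apply: le_trans (scale_cost_le r t hf _ w) _.
    apply: le_trans (ler_wpM2l _ (label_cost_trivial r t hf (top - 1 - (b +
      lk)%N%:Z) w)) _.
      by rewrite mulr_ge0// ltW ?dyad_gt0.
    have /andP[_ h] := dyad_log2_ceil D_gt0.
    have -> : top - 1 - (b + lk)%N%:Z = top - (b + lk.+1)%N%:Z by lia.
    rewrite dyadB exprD exprS.
    have klk : k%:R <= 2 ^+ lk :> R.
      by rewrite -natrX ler_nat ltnW// trunc_log_ltn.
    have e1 : 0 < 2 ^+ lk :> R by rewrite exprn_gt0.
    have e2 : 0 < 2 ^+ b :> R by rewrite exprn_gt0.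
    move: klk e1 e2; move: (2 ^+ lk) (2 ^+ b) => x y klk x0 y0.
    have -> : 9 * (dyad R top / (y * (2 * x))) * (k%:R * f 1) =
        9 * f 1 * y^-1 * (dyad R top / 2 * (k%:R / x)).
      by field; rewrite !gt_eqF.
    have -> : 9 * (f 1 * D) / y = 9 * f 1 * y^-1 * (D * 1) by ring.
    apply: ler_wpM2l; first by rewrite !mulr_ge0// invr_ge0 ltW.
    apply: ler_pM.
    - by rewrite divr_ge0// ltW ?dyad_gt0.
    - by rewrite divr_ge0// ltW.
    - by rewrite ler_pdivrMr// mulrC.
    - by rewrite ler_pdivrMr// mul1r.
  rewrite -mulr_sumr; have := geometric_sum_le R m.
  have : 0 <= f 1 * D by rewrite mulr_ge0.
  nra.
rewrite addrA; have := tail_scales (\max_(i < k) absz (top - T i +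
  i.+1%:Z)%R)%N.
by move: head_scales first_hops; lra.
Qed.

Lemma expected_cost_le :
  ('E_(coin R)[fun w => cost f (run (algorithm w) r t)]
     <= (1812 * ln (k%:R : R) ^+ 2 * cost f Q)%:E)%E.
Proof.
have [f0 fge0 _ _] := hf; have [i0 far] := farthest_terminal.
set D := mdist r (term i0) in far; pose top := log2_ceil D.
have D0 : 0 <= D by exact: mdist_ge0.
pose prob (q : nat * (V * V)) : R :=
  9 / 2 * rate R k * mdist q.2.1 q.2.2 / dyad R (top - 1 - q.1%:Z).
have pointwise w := cost_algorithm_scales w far.
apply: le_trans (@expectation_le_indic R _ _ (coin R) _ _ scales (scale_set top)
  (scale_weight top) prob (24 * (f 1 * D)) _ _ _ _ _ pointwise) _.
- by rewrite !mulr_ge0// fge0.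
- by move=> w; exact: cost_ge0.
- by move=> q; exact: measurable_label_neq.
- exact: scale_weight_ge0.
- by move=> q; exact: coin_label_neq.
rewrite lee_fin.
(* The radius cancels between weight and probability, so all scales contribute equally. Here 81 is 9
   times 9/2 times 2, as the sum over ordered pairs is twice the cost. *)
have -> : \sum_(q <- scales) scale_weight top q * prob q =
    (trunc_log 2 k).+1%:R * (81 * rate R k * cost f Q).
  rewrite /scales big_allpairs/= mulr_natl -[X in _ *+ X]subn0 -sumr_const_nat.
  apply: eq_bigr => a _; rewrite /pairs big_allpairs /cost mulrA mulr_sumr.
  apply: eq_bigr => x _; rewrite mulr_sumr; apply: eq_bigr => y _.
  by rewrite /scale_weight /prob /=; field; rewrite gt_eqF ?dyad_gt0.
have fD : f 1 * D <= 2 * cost f Q by rewrite /D metric_sym; exact: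
  cost_ge_mdist.
have c0 := cost_ge0 Q hf; have l2 := ln2_ge R.
have hk : 2^-1 <= ln k%:R :> R.
  by apply: le_trans l2 _; rewrite ler_ln ?posrE ?ltr0n ?ler_nat//; lia.
have hL := trunc_log2_le R k_ge2; have hr := rate_le R k_ge2.
have r0 := rate_ge0 R k.
move: hL hr hk r0 fD c0.
move: (_.+1%:R) (rate R k) (ln k%:R) (cost f Q) (f 1 * D) (ler0n R (trunc_log 2
  k).+1).
move=> L a l c m L0 hL ha hl a0 hm c0.
(* The final constant is [1812 = 81 * 20 + 24 * 2 * 4], where the last 4 comes from
   [1 <= 4 * l ^+ 2]. *)
have La : L * a <= 20 * l ^+ 2.
  rewrite (_ : 20 * _ = (4 * l) * (5 * l)); last by ring.
  exact: ler_pM.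
have l4 : 1 <= 4 * l ^+ 2 by nra.
have h1 : (L * a) * c <= 20 * l ^+ 2 * c by exact: ler_wpM2r.
have h2 : 1 * c <= 4 * l ^+ 2 * c by exact: ler_wpM2r.
nra.
Qed.

End ExpectedCost.

Lemma algorithm_randomized (R : realType) :
  randomized_online_algorithm (fun w : R => algorithm w).
Proof.
split; first by move=> n D p; exact: measurable_algorithm.
by move=> w V k r t i; rewrite -(point_tnth r); exact: algorithm_is_path.
Qed.

Theorem theorem2 (R : realType) :
  exists (d : measure_display) (Omega : measurableType d)
         (P : probability Omega R) (A : Omega -> online_algorithm R) (C : R),
    randomized_online_algorithm A /\
    forall (V : metricType R) (r : V) (k : nat) (t : k.-tuple V) (f : R -> R),
      (2 <= k)%N -> cost_function f ->
      ('E_P[fun w => cost f (run (A w) r t)]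
         <= (C * ln (k%:R : R) ^+ 2 * OPT f r t)%:E)%E.
Proof.
exists _, _, (coin R), (fun w => algorithm w), 1812.
split; first exact: algorithm_randomized.
move=> V r k t f k2 hf; set X := fun w => _.
set C := 1812 * _.
have C0 : 0 < C by rewrite mulr_gt0 ?ltr0n ?exprn_gt0 ?ln_gt0 ?ltr1n.
have EQ Q : is_routing r t Q -> ('E_(coin R)[X] <= (C * cost f Q)%:E)%E.
  by move=> hQ; exact: expected_cost_le.
(* The run at outcome 0 is itself a routing: it makes the expectation finite and shows that [OPT] is
   the infimum of a nonempty set. *)
have Q0 := (algorithm_randomized R).2 0 V k r t.
have E0 : (0 <= 'E_(coin R)[X])%E.
  by apply: expectation_ge0 => w; exact: cost_ge0.
have : ('E_(coin R)[X])%E \is a fin_num.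
  by rewrite ge0_fin_numE//; apply: le_lt_trans (EQ _ Q0) _; rewrite ltry.
move=> /fineK Efin; rewrite -Efin lee_fin mulrC -ler_pdivrMr//.
apply: lb_le_inf; first by exists (cost f (run (algorithm 0) r t)), (run
  (algorithm 0) r t).
by move=> _ [Q hQ <-]; rewrite ler_pdivrMr// mulrC -lee_fin Efin; exact: EQ.
Qed.
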